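(* Let $K(m)$ be the cell-centered finite volume matrix and let $B_{AGKS}(m)$ be the preconditioner, both defined in the context. There exist constants $c>0$ and $m_0\ge 1$, independent of $m$, such that for all $m\ge m_0$ $$\sigma\big(B_{AGKS}(m)\,K(m)\big)\subset\big[\,1-c\,m^{-1/2},\;1+c\,m^{-1/2}\,\big],$$ and therefore $$\kappa\big(B_{AGKS}(m)\,K(m)\big)=1+\mathcal{O}(m^{-1/2})\qquad (m\to\infty).$$
   Context: Grid and coefficient. The unit square $\Omega$ is divided into a fixed uniform $N\times N$ grid of square cells, one unknown per cell. Two cells are adjacent if they share an edge. The set of cells is partitioned as $H\cup L$ (disjoint), where $H$ is a nonempty edge-connected set of cells (the highly-diffusive island) none of which has an edge on $\partial\Omega$. For $m\ge 1$ let $\alpha_p=m$ if $p\in H$ and $\alpha_p=1$ if $p\in L$. Matrix. $K(m)$ is the symmetric positive definite matrix of the 5-point conservative finite volume discretization (harmonic averaging) of $-\nabla\cdot(\alpha\nabla u)=f$ with $u=0$ on $\partial\Omega$: for adjacent cells $p\neq q$, $[K(m)]_{pq}=-\frac{2\alpha_p\alpha_q}{\alpha_p+\alpha_q}$; for non-adjacent $p\ne q$, $[K(m)]_{pq}=0$; and $[K(m)]_{pp}=\sum_{q\text{ adjacent to }p}\frac{2\alpha_p\alpha_q}{\alpha_p+\alpha_q}+2\alpha_p\cdot\#\{\text{edges of }p\text{ on }\partial\Omega\}$. Thus the $H$–$H$ coupling is $m$, the $L$–$L$ coupling is $1$, and the $H$–$L$ coupling is $\overline h_m=\frac{2m}{m+1}$.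 Write $K(m)=\begin{bmatrix} K_{HH}(m) & K_{HL}(m) \\ K_{LH}(m) & K_{LL}(m) \end{bmatrix}$ according to $H\cup L$. Limits. As $m\to\infty$ the blocks $K_{HL}(m),K_{LH}(m),K_{LL}(m)$ converge entrywise to limits $K_{HL}^\infty,K_{LH}^\infty,K_{LL}^\infty$. Let $n_H=|H|$, let $e_H\in\mathbb{R}^{n_H}$ be the vector with all entries $n_H^{-1/2}$, and put $\eta(m)=e_H^TK_{HH}(m)e_H$ and $\eta=\lim_{m\to\infty}\eta(m)>0$. Define $$K_{HH}^{\infty\dagger}=e_H\eta^{-1}e_H^T,\quad Q_{LH}^\infty=K_{LH}^\infty K_{HH}^{\infty\dagger},\quad S^\infty=K_{LL}^\infty-K_{LH}^\infty K_{HH}^{\infty\dagger}K_{HL}^\infty .$$ Preconditioner. $$B_{AGKS}(m)=\begin{bmatrix} I_{HH} & -(Q_{LH}^{\infty})^T \\ 0 & I_{LL} \end{bmatrix}\begin{bmatrix} K_{HH}(m)^{-1} & 0 \\ 0 & (S^\infty)^{-1} \end{bmatrix}\begin{bmatrix} I_{HH} & 0 \\ -Q_{LH}^\infty & I_{LL} \end{bmatrix}.$$ Conventions. $\sigma$ denotes the spectrum; for a matrix with real positive spectrum, $\kappa$ denotes the ratio of its largest to its smallest eigenvalue. The grid and the sets $H,L$ are fixed; implied constants in $\mathcal O$ are independent of $m$. *)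

(* Defs.v *)
From mathcomp Require Import all_boot all_order all_algebra.
From mathcomp Require Import boolp classical_sets functions reals topology.
From mathcomp Require Import normedtype landau exp.
From mathcomp Require Import complex.

Set Implicit Arguments.
Unset Strict Implicit.
Unset Printing Implicit Defensive.

Import Order.TTheory GRing.Theory Num.Theory.
Import numFieldNormedType.Exports.

Local Open Scope ring_scope.
Local Open Scope classical_set_scope.

(* A cell of the N x N grid is the pair of its coordinates. *)
Notation cell N := ('I_N * 'I_N)%type.

Definition adjacent (N : nat) (p q : cell N) : bool :=
  ((p.1 == q.1) && ((p.2.+1 == q.2 :> nat) || (q.2.+1 == p.2 :> nat)))
  || ((p.2 == q.2) && ((p.1.+1 == q.1 :> nat) || (q.1.+1 == p.1 :> nat))).

Definition nb_boundary_edges (N : nat) (p : cell N) : nat :=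
  ((p.1 == 0 :> nat) + (p.1.+1 == N) + (p.2 == 0 :> nat) + (p.2.+1 == N))%N.

(* Any two cells of [H] are joined by a path of adjacent cells inside [H]. *)
Definition edge_connected (N : nat) (H : {set cell N}) : Prop :=
  {in H &, forall p q,
    connect [rel x y | [&& x \in H, y \in H & adjacent x y]] p q}.

Section Discretization.
Variables (R : realType) (N : nat) (H : {set cell N}).
Implicit Type m : R.

Let L : {set cell N} := ~: H.

Definition alpha m (p : cell N) : R := if p \in H then m else 1.

Definition harmonic m (p q : cell N) : R :=
  2 * alpha m p * alpha m q / (alpha m p + alpha m q).

Definition Kcoef m (p q : cell N) : R :=
  if p == q then
    \sum_(r | adjacent p r) harmonic m p r
      + 2 * alpha m p * (nb_boundary_edges p)%:R
  else if adjacent p q then - harmonic m p q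
  else 0.

(* The rows and columns of a block are numbered by the enumerations of the
   sets of cells [A] and [B]. *)
Definition Kblock (A B : {set cell N}) m : 'M[R]_(#|A|, #|B|) :=
  \matrix_(i, j) Kcoef m (enum_val i) (enum_val j).

Definition Kmx m : 'M[R]_(#|H| + #|L|) :=
  block_mx (Kblock H H m) (Kblock H L m) (Kblock L H m) (Kblock L L m).

Definition Kblock_lim (A B : {set cell N}) : 'M[R]_(#|A|, #|B|) :=
  \matrix_(i, j) lim (Kblock A B m i j @[m --> +oo]).

Definition eH : 'cV[R]_#|H| := const_mx (#|H|%:R `^ (- 2^-1)).

Definition eta m : R := (eH^T *m Kblock H H m *m eH) 0 0.

Definition eta_lim : R := lim (eta m @[m --> +oo]).

Definition KHH_dagger : 'M[R]_#|H| := eH *m (eta_lim^-1)%:M *m eH^T.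

Definition QLH_lim : 'M[R]_(#|L|, #|H|) := Kblock_lim L H *m KHH_dagger.

Definition S_lim : 'M[R]_#|L| :=
  Kblock_lim L L - Kblock_lim L H *m KHH_dagger *m Kblock_lim H L.

Definition B_AGKS m : 'M[R]_(#|H| + #|L|) :=
  block_mx 1%:M (- QLH_lim^T) 0 1%:M
  *m block_mx (invmx (Kblock H H m)) 0 0 (invmx S_lim)
  *m block_mx 1%:M 0 (- QLH_lim) 1%:M.

End Discretization.

(* The spectrum is taken in the complex numbers, so that its inclusion in a
   real interval says in particular that every eigenvalue is real. *)
Definition spectrum (R : realType) (n : nat) (A : 'M[R]_n) : set R[i] :=
  [set z | eigenvalue (map_mx (real_complex R) A) z].

(* Only meaningful when the spectrum of [A] is real and positive; being finite,
   it then attains its supremum and its infimum. *)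
Definition kappa (R : realType) (n : nat) (A : 'M[R]_n) : R :=
  sup [set x : R | spectrum A (real_complex R x)]
    / inf [set x : R | spectrum A (real_complex R x)].

(* Main.v *)
Require Import Defs.
From mathcomp Require Import all_boot all_order all_algebra.
From mathcomp Require Import boolp classical_sets functions reals topology.
From mathcomp Require Import normedtype landau exp.
From mathcomp Require Import complex.
From mathcomp Require Import ring lra.

Set Implicit Arguments.
Unset Strict Implicit.
Unset Printing Implicit Defensive.

Import Order.TTheory GRing.Theory Num.Theory.
Import numFieldNormedType.Exports.

Local Open Scope ring_scope.
Local Open Scope classical_set_scope.

(* On an interior island [K(m) = [m N + h D, - h A; - h A^T, T + h E]] with
   [h = 2 m / (m + 1)], where [N] is the Neumann Laplacian of the island, whose
   kernel is spanned by [e], and where [N], [D], [A], [T], [E] do not depend on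
   [m].  With [Q = Q_LH^oo], shearing by [[1, 0; Q, 1]] turns the inverse of
   [B_AGKS(m)] into [diag(K_HH(m), S)], and [K(m)] into the same matrix
   perturbed by an off-diagonal block [h F] and by a diagonal block
   [(h - 2) Z = O(1/m)].
   The definition of [eta] gives [e^T F = 0], so that [F = N G] for some [G];
   Cauchy-Schwarz for [N] then bounds the off-diagonal block by [m^(-1/2)] times
   [diag(K_HH(m), S)], because [m N <= K_HH(m)].  Hence the quadratic forms of
   [K(m)] and of the inverse of [B_AGKS(m)] agree up to a factor
   [1 + O(m^(-1/2))], and so do the eigenvalues of the pencil. *)

(** * Bilinear forms and positive definite matrices *)

Section QuadraticForms.
Variables (R : realFieldType).

Definition bform n p (M : 'M[R]_(n, p)) (u : 'rV[R]_n) (v : 'rV[R]_p) : R :=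
  (u *m M *m v^T) 0 0.

Definition posdef n (S : 'M[R]_n) : Prop :=
  S^T = S /\ forall v, v != 0 -> 0 < bform S v v.

Lemma bform_tr n p (M : 'M[R]_(n, p)) u v : bform M^T v u = bform M u v.
Proof.
rewrite /bform -[in RHS](trmxK (u *m M *m v^T)) [RHS]mxE.
by rewrite !trmx_mul trmxK mulmxA.
Qed.

Lemma bformC n (M : 'M[R]_n) u v : M^T = M -> bform M u v = bform M v u.
Proof. by move=> sM; rewrite -{1}sM bform_tr. Qed.

Lemma bform_mx0 n p u v : bform (0 : 'M[R]_(n, p)) u v = 0.
Proof. by rewrite /bform mulmx0 mul0mx mxE. Qed.

Lemma bformDm n p (M M' : 'M[R]_(n, p)) u v :
  bform (M + M') u v = bform M u v + bform M' u v.
Proof. by rewrite /bform mulmxDr mulmxDl mxE. Qed.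

Lemma bformNm n p (M : 'M[R]_(n, p)) u v : bform (- M) u v = - bform M u v.
Proof. by rewrite /bform mulmxN mulNmx mxE. Qed.

Lemma bformZm n p k (M : 'M[R]_(n, p)) u v :
  bform (k *: M) u v = k * bform M u v.
Proof. by rewrite /bform -scalemxAr -scalemxAl mxE. Qed.

Lemma bformMm n p q (M : 'M[R]_(n, p)) (M' : 'M[R]_(p, q)) u v :
  bform (M *m M') u v = bform M' (u *m M) v.
Proof. by rewrite /bform !mulmxA. Qed.

Lemma bformMr n p q (M : 'M[R]_(n, p)) (M' : 'M[R]_(p, q)) u v :
  bform (M *m M') u v = bform M u (v *m M'^T).
Proof. by rewrite /bform trmx_mul trmxK !mulmxA. Qed.

Lemma bformDl n p (M : 'M[R]_(n, p)) u u' v :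
  bform M (u + u') v = bform M u v + bform M u' v.
Proof. by rewrite /bform !mulmxDl mxE. Qed.

Lemma bformDr n p (M : 'M[R]_(n, p)) u v v' :
  bform M u (v + v') = bform M u v + bform M u v'.
Proof. by rewrite /bform linearD mulmxDr mxE. Qed.

Lemma bformNl n p (M : 'M[R]_(n, p)) u v : bform M (- u) v = - bform M u v.
Proof. by rewrite /bform !mulNmx mxE. Qed.

Lemma bformNr n p (M : 'M[R]_(n, p)) u v : bform M u (- v) = - bform M u v.
Proof. by rewrite /bform linearN mulmxN mxE. Qed.

Lemma bformZl n p k (M : 'M[R]_(n, p)) u v :
  bform M (k *: u) v = k * bform M u v.
Proof. by rewrite /bform -!scalemxAl mxE. Qed.

Lemma bformZr n p k (M : 'M[R]_(n, p)) u v :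
  bform M u (k *: v) = k * bform M u v.
Proof. by rewrite /bform linearZ -scalemxAr mxE. Qed.

Lemma bform0l n p (M : 'M[R]_(n, p)) v : bform M 0 v = 0.
Proof. by rewrite /bform !mul0mx mxE. Qed.

Lemma bform0r n p (M : 'M[R]_(n, p)) u : bform M u 0 = 0.
Proof. by rewrite /bform trmx0 mulmx0 mxE. Qed.

Definition bformE := (bformDm, bformNm, bformZm, bformDl, bformDr, bformNl,
  bformNr, bformZl, bformZr, bform0l, bform0r).

Lemma bform_sum n p (M : 'M[R]_(n, p)) u v :
  bform M u v = \sum_i \sum_j u 0 i * M i j * v 0 j.
Proof.
rewrite /bform mxE exchange_big; apply: eq_bigr => j _.
by rewrite !mxE mulr_suml.
Qed.

Lemma bform_block n p (M1 : 'M[R]_n) (M2 : 'M[R]_(n, p)) (M3 : 'M[R]_(p, n))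
    (M4 : 'M[R]_p) u v u' v' :
  bform (block_mx M1 M2 M3 M4) (row_mx u v) (row_mx u' v') =
  bform M1 u u' + bform M3 v u' + bform M2 u v' + bform M4 v v'.
Proof.
rewrite /bform mul_row_block tr_row_mx mul_row_col !mulmxDl !mxE.
by rewrite !addrA.
Qed.

Lemma posdef_unit n (S : 'M[R]_n) : posdef S -> S \in unitmx.
Proof.
case=> _ pS; rewrite unitmxE unitfE; apply/det0P => -[v vn0 vS].
by have := pS v vn0; rewrite /bform vS mul0mx mxE ltxx.
Qed.

Lemma posdef_ge0 n (S : 'M[R]_n) v : posdef S -> 0 <= bform S v v.
Proof.
case=> _ pS; have [->|/pS/ltW //] := eqVneq v 0.
by rewrite bform0l.
Qed.

Lemma bform_le_norm n (X : 'M[R]_n) :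
  exists2 c, 0 < c & forall v, `|bform X v v| <= c * bform 1%:M v v.
Proof.
(* The [1] keeps the constant positive when [X] is zero; the sum suffices because each [|v_i| |v_j|]
   is at most the squared norm of [v]. *)
exists (1 + \sum_i \sum_j `|X i j|).
  by rewrite ltr_pwDl // sumr_ge0 // => i _; rewrite sumr_ge0.
move=> v.
have nE : bform 1%:M v v = \sum_i v 0 i ^+ 2.
  by rewrite /bform mulmx1 mxE; apply: eq_bigr => i _; rewrite mxE expr2.
have n_ge0 : 0 <= bform 1%:M v v.
  by rewrite nE sumr_ge0 // => i _; exact: sqr_ge0.
have le_n i : `|v 0 i| ^+ 2 <= bform 1%:M v v.
  rewrite nE (bigD1 i) //= real_normK ?num_real // lerDl.
  by rewrite sumr_ge0 // => j _; rewrite sqr_ge0.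
rewrite mulrDl mul1r ler_wpDl //.
rewrite bform_sum mulr_suml (le_trans (ler_norm_sum _ _ _)) //.
apply: ler_sum => i _; rewrite mulr_suml (le_trans (ler_norm_sum _ _ _)) //.
apply: ler_sum => j _; rewrite !normrM mulrAC mulrC ler_wpM2l //.
have := le_n i; have := le_n j; have := sqr_ge0 (`|v 0 i| - `|v 0 j|).
nra.
Qed.

(** If [c] bounds the form of [S^-1], expanding the form of [S] at [c v - v S^-1] gives
    [c (c v S v - |v|^2) >= 0]. *)
Lemma norm_le_posdef n (S : 'M[R]_n) : posdef S ->
  exists2 c, 0 < c & forall v, bform 1%:M v v <= c * bform S v v.
Proof.
move=> pS; have uS := posdef_unit pS; have sS := pS.1.
have [c c0 cP] := bform_le_norm (invmx S).
exists c => // v.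
(* The vector below plays Cauchy-Schwarz between [v] and [v S^-1]. *)
have := posdef_ge0 (c *: v - v *m invmx S) pS.
have e1 w : bform S (v *m invmx S) w = bform 1%:M v w.
  by rewrite -bformMm mulVmx.
have e2 : bform 1%:M v (v *m invmx S) = bform (invmx S) v v.
  by rewrite -{1}sS -trmx_inv -bformMr mul1mx.
rewrite !bformE (bformC v (v *m invmx S)) // !e1 e2 => h.
have := le_trans (ler_norm _) (cP v) => h1.
have : 0 <= c * (c * bform S v v - bform 1%:M v v).
  apply: le_trans h _. lra.
by rewrite pmulr_rge0 // subr_ge0.
Qed.

Lemma bform_le_posdef n (S X : 'M[R]_n) : posdef S ->
  exists2 c, 0 < c & forall v, `|bform X v v| <= c * bform S v v.
Proof.
move=> /norm_le_posdef[c c0 cP]; have [k k0 kP] := bform_le_norm X.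
exists (k * c) => [|v]; first exact: mulr_gt0.
by rewrite (le_trans (kP v)) // -mulrA ler_wpM2l // ltW.
Qed.

(* The Gram matrix form of AM-GM, [2 |w N g| <= d (m w N w + g N g)] when
   [d ^ 2 m = 1]. *)
Lemma bform_amgm n (M : 'M[R]_n) (m d : R) w g :
  M^T = M -> (forall v, 0 <= bform M v v) -> 0 < d -> d ^+ 2 * m = 1 ->
  `|2 * bform M w g| <= d * (m * bform M w w + bform M g g).
Proof.
move=> sM pM d0 dm.
(* Multiplied by [d] and simplified with [d ^ 2 m = 1], these two inequalities are the two sides of
   the absolute value bound. *)
have h1 := pM (d * m *: w + g); have h2 := pM (d * m *: w - g).
rewrite !bformE (bformC g w sM) in h1 h2.
have := mulr_ge0 (ltW d0) h2; have := mulr_ge0 (ltW d0) h1.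
move: (bform M w w) (bform M w g) (bform M g g) => a b c.
move=> g2 g1.
have : 0 <= (d ^+ 2 * m) * (d * m * a + 2 * b) + d * c by lra.
have : 0 <= (d ^+ 2 * m) * (d * m * a - 2 * b) + d * c by lra.
rewrite dm ler_norml => *; apply/andP; split; lra.
Qed.

End QuadraticForms.

(** * Complex spectrum and condition number of a real matrix *)

Section Spectrum.
Variable (R : realType).
Local Notation Re := (@complex.Re R).
Local Notation Im := (@complex.Im R).

(** Since [A] is real, a complex eigenvector equation splits into two real ones; this lemma and the
    next three do the splitting. *)
Lemma map_Re_mulmx n p (v : 'rV[R[i]]_n) (A : 'M[R]_(n, p)) :
  map_mx Re (v *m map_mx (real_complex R) A) = map_mx Re v *m A.
Proof.
apply/rowP => j; rewrite !mxE raddf_sum; apply: eq_bigr => i _.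
by rewrite !mxE; case: (v 0 i) => a b /=; rewrite mulr0 subr0.
Qed.

Lemma map_Im_mulmx n p (v : 'rV[R[i]]_n) (A : 'M[R]_(n, p)) :
  map_mx Im (v *m map_mx (real_complex R) A) = map_mx Im v *m A.
Proof.
apply/rowP => j; rewrite !mxE raddf_sum; apply: eq_bigr => i _.
by rewrite !mxE; case: (v 0 i) => a b /=; rewrite mulr0 add0r mulrC.
Qed.

Lemma map_Re_scale n (z : R[i]) (v : 'rV[R[i]]_n) :
  map_mx Re (z *: v) = Re z *: map_mx Re v - Im z *: map_mx Im v.
Proof. by apply/rowP => j; rewrite !mxE; case: z (v 0 j) => [? ?] []. Qed.

Lemma map_Im_scale n (z : R[i]) (v : 'rV[R[i]]_n) :
  map_mx Im (z *: v) = Im z *: map_mx Re v + Re z *: map_mx Im v.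
Proof.
apply/rowP => j; rewrite !mxE.
by case: z (v 0 j) => [? ?] [? ?] /=; rewrite addrC.
Qed.

(* A left eigenvector [v] of [B K] yields [y = v B] with [y K = z y W], a
   generalized eigenvector of the pencil [(K, W)]. *)
Lemma spectrum_pencil n (B K W : 'M[R]_n) (d : R) :
  B *m W = 1%:M -> K^T = K -> posdef W ->
  (forall a, `|bform K a a - bform W a a| <= d * bform W a a) ->
  spectrum (B *m K) `<=` real_complex R @` `[1 - d, 1 + d].
Proof.
move=> BW sK [sW pW] dP z /eigenvalueP[v vE vn0].
have eRe := congr1 (map_mx Re) vE; have eIm := congr1 (map_mx Im) vE.
rewrite map_Re_mulmx map_Re_scale in eRe.
rewrite map_Im_mulmx map_Im_scale in eIm.
have an0 : (map_mx Re v != 0) || (map_mx Im v != 0).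
  rewrite -negb_and; apply: contraNN vn0 => /andP[/eqP a0 /eqP b0].
  apply/eqP/rowP => j; move/rowP: a0 => /(_ j); move/rowP: b0 => /(_ j).
  by rewrite !mxE; case: (v 0 j) => [? ?] /= -> ->.
move: (map_mx Re v) (map_mx Im v) eRe eIm an0 => a b eRe eIm an0.
have inB (c : 'rV[R]_n) : c = c *m B *m W by rewrite -mulmxA BW mulmx1.
have Bn0 (c : 'rV[R]_n) : c != 0 -> c *m B != 0.
  by apply: contraNneq => c0; rewrite (inB c) c0 mul0mx.
have {}an0 : (a *m B != 0) || (b *m B != 0).
  by case/orP: an0 => /Bn0 ->; rewrite ?orbT.
(* With [y = a B] and [x = b B], the equations become [y K = Re z y W - Im z x W] and
   [x K = Im z y W + Re z x W]. *)
rewrite mulmxA {2}(inB a) (inB b) in eRe.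
rewrite mulmxA (inB a) {2}(inB b) in eIm.
move: (a *m B) (b *m B) eRe eIm an0 => {Bn0 inB vE vn0}y x eRe eIm an0.
have KE c : bform K y c = Re z * bform W y c - Im z * bform W x c.
  by rewrite /bform eRe mulmxBl -!scalemxAl !mxE.
have KE' c : bform K x c = Im z * bform W y c + Re z * bform W x c.
  by rewrite /bform eIm mulmxDl -!scalemxAl !mxE.
have W0 c : 0 <= bform W c c by exact: posdef_ge0.
have Wgt : 0 < bform W y y + bform W x x.
  by case/orP: an0 => /pW h; [apply: ltr_pwDl|apply: ltr_wpDl].
(* Symmetry of [K] and [W] equates two expressions of [bform K y x]; their difference is [Im z]
   times a positive number. *)
have Im0 : Im z = 0.
  have := KE x; rewrite (bformC _ _ sK) KE' (bformC x y sW) => e.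
  have : Im z * (bform W y y + bform W x x) = 0 by lra.
  by move/eqP; rewrite mulf_eq0 (gt_eqF Wgt) orbF => /eqP.
(* Once [z] is real, whichever of [y] and [x] is nonzero has Rayleigh quotient [Re z], which [dP]
   confines. *)
have key c : c != 0 -> bform K c c = Re z * bform W c c ->
    1 - d <= Re z <= 1 + d.
  move=> /pW c0 cE; have := dP c; rewrite cE.
  rewrite -{2}[bform W c c]mul1r -mulrBl normrM (gtr0_norm c0).
  by rewrite ler_pM2r // ler_distl.
exists (Re z); last by case: z Im0 {eRe eIm KE KE' key} => ? ? /= ->.
rewrite /= in_itv /=; case/orP: an0 => /key; apply.
  by rewrite KE Im0 mul0r subr0.
by rewrite KE' Im0 mul0r add0r.
Qed.

(** The characteristic polynomial has a complex root. This keeps the [sup] and [inf] in [kappa] off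
    the empty set and its default values. *)
Lemma spectrum_nonempty n (A : 'M[R]_n) : (0 < n)%N -> exists z, spectrum A z.
Proof.
move=> n0; have /closed_rootP[z zP] :
    size (char_poly (map_mx (real_complex R) A)) != 1%N.
  by rewrite size_char_poly; case: n n0 A.
by exists z; rewrite /spectrum /= eigenvalue_root_char.
Qed.

(** The ratio is at least 1 and at most [(1 + d) / (1 - d)], and [2 d / (1 - d) <= 4 d] when
    [d <= 1 / 2]. *)
Lemma kappa_near1 n (A : 'M[R]_n) (d : R) : (0 < n)%N -> d <= 2^-1 ->
  spectrum A `<=` real_complex R @` `[1 - d, 1 + d] ->
  `|kappa A - 1| <= 4 * d.
Proof.
move=> n0 d2 sA; rewrite /kappa; set X := [set x : R | _].
have XP x : X x -> 1 - d <= x <= 1 + d.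
  by move=> /sA[y]; rewrite /= in_itv /= => yP [<-].
have [x Xx] : X !=set0.
  have [z zA] := spectrum_nonempty A n0; have [y _ yz] := sA z zA.
  by exists y; rewrite /X /= yz.
have hs : has_ubound X by exists (1 + d) => y /XP/andP[].
have hi : has_lbound X by exists (1 - d) => y /XP/andP[].
have s1 : sup X <= 1 + d by apply: ge_sup => [|y /XP/andP[]]; first by exists x.
have i1 : 1 - d <= inf X.
  by apply: lb_le_inf => [|y /XP/andP[]]; first by exists x.
have s2 : x <= sup X by apply: ub_le_sup.
have i2 : inf X <= x by apply: ge_inf.
have i0 : 0 < inf X by lra.
rewrite ler_norml; apply/andP; split.
  by have : 1 <= sup X / inf X; [rewrite ler_pdivlMr //; lra|lra].
by rewrite lerBlDr ler_pdivrMr //; nra.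
Qed.

End Spectrum.

(** * The island matrix in block form and its comparison with the preconditioner *)

Section Perturbation.
Variables (R : realType) (n l : nat).
Variables (N D : 'M[R]_n) (A : 'M[R]_(n, l)) (T E : 'M[R]_l) (e : 'cV[R]_n).

(** Half of the limit [eta]: as [N e = 0], the form of [m N + h D] at [e] is [h d], and [h] tends to
    2. *)
Definition coupling : R := bform D e^T e^T.
Local Notation d := coupling.

Definition coupling_sqr : 'M[R]_l := A^T *m e *m e^T *m A.
Local Notation P := coupling_sqr.

(** This is [Q_LH^oo]: the factor 2 of [K_LH^oo = - 2 A^T] cancels against [eta = 2 d]. *)
Definition shear : 'M[R]_(l, n) := - (d^-1 *: (A^T *m e *m e^T)).
Local Notation Q := shear.

(** This is [S^oo], where [h] has its limit 2 and the correction is [4 P / eta]. *)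
Definition schur : 'M[R]_l := T + 2 *: E - (2 / d) *: P.
Local Notation S := schur.

(* [T] is the part of [K_LL] that does not depend on [m]; [h D] and [h E] come
   from the edges between the island and its complement. *)
Definition island_mx (m h : R) : 'M[R]_(n + l) :=
  block_mx (m *: N + h *: D) (- h *: A) (- h *: A^T) (T + h *: E).

(** The inverses of the three factors of the preconditioner, in reverse order. *)
Definition precond_inv_mx (m h : R) : 'M[R]_(n + l) :=
  block_mx 1%:M 0 Q 1%:M *m block_mx (m *: N + h *: D) 0 0 S
    *m block_mx 1%:M Q^T 0 1%:M.

Hypothesis e_unit : e^T *m e = 1%:M.
Hypotheses (N_sym : N^T = N) (D_sym : D^T = D).
Hypotheses (T_sym : T^T = T) (E_sym : E^T = E).
Hypothesis Ne0 : N *m e = 0.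
Hypothesis N_ge0 : forall w, 0 <= bform N w w.
Hypothesis D_ge0 : forall w, 0 <= bform D w w.
Hypothesis N_ker : forall w, bform N w w = 0 -> w *m e = 0 -> w = 0.
Hypothesis island_posdef : forall m h, 0 < m -> 0 < h -> posdef (island_mx m h).

Lemma island_HH_posdef m h : 0 < m -> 0 < h -> posdef (m *: N + h *: D).
Proof.
move=> m0 h0; split; first by rewrite linearD !linearZ /= N_sym D_sym.
move=> v vn0; have [_ /(_ (row_mx v 0))] := island_posdef m0 h0.
rewrite bform_block !bform0l !bform0r !addr0; apply.
by apply: contraNneq vn0; rewrite -row_mx0 => /eq_row_mx[->].
Qed.

Lemma e_neq0 : e^T != 0.
Proof.
apply/eqP => e0; move: e_unit; rewrite e0 mul0mx => /matrixP/(_ 0 0).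
by rewrite !mxE => /esym/eqP; rewrite oner_eq0.
Qed.

Lemma bform_N_e : bform N e^T e^T = 0.
Proof. by rewrite /bform trmxK -mulmxA Ne0 mulmx0 mxE. Qed.

(** The island block is positive definite, and at [e] only its [D] part contributes. *)
Lemma coupling_gt0 : 0 < d.
Proof.
have [_ /(_ _ e_neq0)] := island_HH_posdef ltr01 ltr01.
by rewrite !scale1r bformDm bform_N_e add0r.
Qed.

Lemma bform_P v : bform P v v = bform A e^T v ^+ 2.
Proof.
have vAe : v *m A^T *m e = (bform A e^T v)%:M.
  by rewrite -bform_tr /bform trmxK -mx11_scalar.
by rewrite /P bformMm !mulmxA vAe mul_scalar_mx bformZl expr2.
Qed.

(* [v S v] is the quadratic form of [island_mx 1 2] at [(t e, v)], for the value
   of [t] that minimizes it; [N] does not contribute since [N e = 0]. *)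
Lemma schur_posdef : posdef S.
Proof.
split.
  rewrite /S linearB linearD !linearZ /= T_sym E_sym /P.
  by rewrite !trmx_mul !trmxK !mulmxA.
move=> v vn0; have d0 := coupling_gt0.
have [_ /(_ (row_mx (bform A e^T v / d *: e^T) v))] :=
  island_posdef ltr01 (ltr0n R 2).
have /[swap]/[apply] : row_mx (bform A e^T v / d *: e^T) v != 0.
  by apply: contraNneq vn0; rewrite -row_mx0 => /eq_row_mx[_ ->].
rewrite bform_block /S !bformE bform_P -/d bform_tr.
rewrite bform_N_e.
move=> /lt_le_trans; apply; rewrite le_eqVlt; apply/predU1P; left.
by field; rewrite gt_eqF.
Qed.

Lemma eN0 : e^T *m N = 0.
Proof. by rewrite -[e^T *m N]trmxK trmx_mul trmxK N_sym Ne0 trmx0. Qed.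

Lemma mul_eDe : e^T *m D *m e = d%:M.
Proof.
by apply/matrixP => i j; rewrite !ord1 /d /bform trmxK !mxE eqxx mulr1n.
Qed.

(** Since [Q N = 0], the shear brings no term of order [m] into the off-diagonal blocks, and the
    lower right block is [S] exactly when [h = 2], up to a multiple of [h - 2] otherwise. *)
Lemma island_congr m h : island_mx m h =
  block_mx 1%:M 0 Q 1%:M
  *m block_mx (m *: N + h *: D) (h *: (d^-1 *: (D *m e *m e^T *m A) - A))
       (h *: (d^-1 *: (A^T *m e *m e^T *m D) - A^T))
       (S + (h - 2) *: (E - d^-1 *: P))
  *m block_mx 1%:M Q^T 0 1%:M.
Proof.
have d0 := coupling_gt0; have dn0 : d != 0 by rewrite gt_eqF.
have QT : Q^T = - (d^-1 *: (e *m e^T *m A)).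
  by rewrite /Q linearN linearZ /= !trmx_mul !trmxK mulmxA.
have QDA : Q *m (D *m e *m e^T *m A) = - P.
  rewrite /Q mulNmx -scalemxAl !mulmxA -[A^T *m e *m e^T *m D]mulmxA.
  rewrite -[A^T *m e *m _ *m e]mulmxA mul_eDe mul_mx_scalar -!scalemxAl.
  by rewrite scalerA mulVf // scale1r.
have QA : Q *m A = - (d^-1 *: P) by rewrite /Q mulNmx -scalemxAl.
have ATQ : A^T *m Q^T = - (d^-1 *: P).
  by rewrite QT mulmxN -scalemxAr !mulmxA.
have QK : Q *m (m *: N + h *: D) = - ((h / d) *: (A^T *m e *m e^T *m D)).
  rewrite /Q mulNmx mulmxDr -!scalemxAl -!scalemxAr -[_ *m N]mulmxA eN0 mulmx0.
  by rewrite !scaler0 add0r scalerA mulrC.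
have KQ : (m *: N + h *: D) *m Q^T = - ((h / d) *: (D *m e *m e^T *m A)).
  rewrite QT mulmxN mulmxDl -!scalemxAr -!scalemxAl !mulmxA Ne0 !mul0mx.
  by rewrite !scaler0 add0r scalerA mulrC.
have E21 : Q *m (m *: N + h *: D) + h *: (d^-1 *: (A^T *m e *m e^T *m D) - A^T)
    = - h *: A^T.
  by rewrite QK scalerBr scalerA addrA addNr add0r scaleNr.
rewrite /island_mx !mulmx_block !mul1mx !mulmx1 !mul0mx !mulmx0 !addr0 ?add0r.
rewrite E21 KQ; congr block_mx.
  by rewrite scalerBr scalerA addrA addNr add0r scaleNr.
(* The rows of [Q] are multiples of [e^T], which annihilates the off-diagonal block by the choice of
   [d]. *)
have QE12 : Q *m (h *: (d^-1 *: (D *m e *m e^T *m A) - A)) = 0.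
  by rewrite -scalemxAr mulmxBr -[Q *m (d^-1 *: _)]scalemxAr QDA QA scalerN
             subrr scaler0.
rewrite -scalemxAl ATQ QE12 add0r /S; apply/matrixP => i j; rewrite !mxE.
by move: (T i j) (E i j) (P i j) => t f p; field.
Qed.

(* The left-hand side is orthogonal to [e], hence in the range of [N]. *)
Lemma flux_range : exists G : 'M[R]_(n, l),
  d^-1 *: (D *m e *m e^T *m A) - A = N *m G.
Proof.
have d0 := coupling_gt0; have dn0 : d != 0 by rewrite gt_eqF.
(* Adding [e e^T] fills the kernel of [N], so [M] is invertible; since [e^T M = e^T], the solution
   of [M G = F] is orthogonal to [e] and satisfies [N G = F]. *)
set F := _ - _; pose M := N + e *m e^T.
have eF : e^T *m F = 0.
  rewrite /F mulmxBr -scalemxAr !mulmxA mul_eDe mul_scalar_mx -scalemxAl.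
  by rewrite scalerA mulVf // scale1r subrr.
have uM : M \in unitmx.
  rewrite unitmxE unitfE; apply/det0P => -[w wn0 wM].
  have ee : bform (e *m e^T) w w = (w *m e) 0 0 ^+ 2.
    rewrite /bform mulmxA -[_ *m e^T *m _]mulmxA -trmx_mul expr2.
    by rewrite mxE big_ord1 [_^T _ _]mxE.
  have M0 : bform M w w = 0 by rewrite /bform wM mul0mx mxE.
  rewrite /M bformDm ee in M0.
  have := N_ge0 w; have := sqr_ge0 ((w *m e) 0 0) => s0 N0.
  have /N_ker : bform N w w = 0 by lra.
  have /eqP : (w *m e) 0 0 ^+ 2 = 0 by lra.
  rewrite sqrf_eq0 => /eqP we0 /(_ _)/eqP; rewrite (negPf wn0) => h.
  by apply: notF; apply: h; rewrite [w *m e]mx11_scalar we0 raddf0.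
exists (invmx M *m F).
have MF : M *m (invmx M *m F) = F by rewrite mulmxA mulmxV // mul1mx.
have eG : e^T *m (invmx M *m F) = 0.
  have := congr1 (mulmx e^T) MF.
  by rewrite {1}/M mulmxA mulmxDr eN0 add0r mulmxA e_unit mul1mx eF.
by rewrite -[LHS]MF {1}/M mulmxDl -[e *m e^T *m _]mulmxA eG mulmx0 addr0.
Qed.

Lemma precond_inv_posdef m h : 0 < m -> 0 < h -> posdef (precond_inv_mx m h).
Proof.
move=> m0 h0; have pK := island_HH_posdef m0 h0; have pS := schur_posdef.
have LE : (block_mx 1%:M 0 Q 1%:M)^T = block_mx 1%:M Q^T 0 1%:M :> 'M_(n + l).
  by rewrite tr_block_mx !trmx1 trmx0.
rewrite /precond_inv_mx; split.
  rewrite -LE !trmx_mul trmxK mulmxA; congr (_ *m _ *m _).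
  by rewrite tr_block_mx !trmx0 pK.1 pS.1.
move=> a an0; rewrite -LE bformMr bformMm trmxK.
set b := a *m _.
have : b != 0.
  apply: contraNneq an0 => b0.
  (* The shear is undone by changing the sign of [Q], so it maps no nonzero vector to zero. *)
  have : b *m block_mx 1%:M 0 (- Q) 1%:M = a.
    rewrite /b -mulmxA mulmx_block !mul1mx !mulmx1 !mul0mx !mulmx0 !addr0.
    by rewrite !add0r subrr -scalar_mx_block mulmx1.
  by rewrite b0 mul0mx => <-.
rewrite -(hsubmxK b) bform_block !bform_mx0 !addr0 => bn0.
have := posdef_ge0 (lsubmx b) pK; have := posdef_ge0 (rsubmx b) pS.
have [l0|/pK.2] := eqVneq (lsubmx b) 0; last lra.
have [r0|/pS.2] := eqVneq (rsubmx b) 0; last lra.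
by move: bn0; rewrite l0 r0 row_mx0 eqxx.
Qed.

(** The bound variable [d] stands for [m^(-1/2)], not for [coupling]. The constant does not depend
    on [m] because [S], [G], [E] and [P] do not. *)
Lemma island_precond_close : exists2 c, 0 < c & forall m h d : R,
  0 < d -> d ^+ 2 * m = 1 -> 1 <= m -> 0 < h -> h <= 2 -> 2 - h <= 2 / m ->
  forall a, `|bform (island_mx m h) a a - bform (precond_inv_mx m h) a a|
    <= c * d * bform (precond_inv_mx m h) a a.
Proof.
have [G GE] := flux_range.
have pS := schur_posdef.
have [c1 c10 c1P] := bform_le_posdef (G^T *m N *m G) pS.
have [c2 c20 c2P] := bform_le_posdef (E - d^-1 *: P) pS.
exists (2 + 2 * c1 + 2 * c2); first lra.
move=> m h dl dl0 dlm m1 h0 h2 hm a.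
have m0 : 0 < m by lra.
have LE : block_mx 1%:M Q^T 0 1%:M = (block_mx 1%:M 0 Q 1%:M)^T :> 'M_(n + l).
  by rewrite tr_block_mx !trmx1 trmx0.
(* In the coordinates [b = a L] both forms lose their shears, and only the middle factors are
   compared. *)
rewrite island_congr /precond_inv_mx LE; set L := block_mx 1%:M 0 Q 1%:M.
rewrite !(bformMr _ L^T) !(bformMm L) trmxK.
move: (a *m _) => b; rewrite -(hsubmxK b) !bform_block !bform_mx0 !addr0.
move: (lsubmx b) (rsubmx b) => w v {L LE a b}.
have -> : d^-1 *: (A^T *m e *m e^T *m D) - A^T = (N *m G)^T.
  by rewrite -GE linearB linearZ /= !trmx_mul trmxK D_sym !mulmxA.
rewrite GE !bformZm bform_tr [bform (S + _) _ _]bformDm bformZm.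
have := bform_amgm w (v *m G^T) N_sym N_ge0 dl0 dlm.
rewrite -bformMr.
have -> : bform N (v *m G^T) (v *m G^T) = bform (G^T *m N *m G) v v.
  by rewrite bformMr bformMm.
have := c1P v; have := c2P v; have := D_ge0 w; have := N_ge0 w.
have := posdef_ge0 v pS.
rewrite [bform (m *: N + _) w w]bformDm !bformZm.
move: (bform S v v) (bform N w w) (bform D w w) (bform (E - _) v v)
  (bform (G^T *m N *m G) v v) (bform (N *m G) w v).
move=> s nw dw z g x s0 nw0 dw0 zP gP xP.
have dl1 : dl <= 1 by rewrite -(@ler_sqr _ dl 1) ?nnegrE ?(ltW dl0) //; nra.
(* The diagonal error is [O(1/m)], hence also [O(m^(-1/2))], because [dl * m = 1 / dl >= 1]. *)
have hdl : 2 - h <= 2 * dl.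
  apply: le_trans hm _; rewrite ler_pdivrMr //.
  suff : 1 <= dl * m by lra.
  have -> : dl * m = 1 / dl by rewrite -dlm; field; rewrite gt_eqF.
  by rewrite ler_pdivlMr // mul1r.
have mn0 : 0 <= m * nw by rewrite mulr_ge0 // ltW.
have hd0 : 0 <= h * dw by rewrite mulr_ge0 // ltW.
have xb : `|h * (2 * x)| <= 2 * (dl * (m * nw + c1 * s)).
  rewrite normrM (gtr0_norm h0); apply: ler_pM; rewrite ?(ltW h0) //.
  by rewrite (le_trans xP) // ler_pM2l // lerD2l (le_trans (ler_norm _)).
have zb : `|(h - 2) * z| <= 2 * dl * (c2 * s).
  by rewrite normrM ler_pM // distrC ger0_norm // subr_ge0.
have -> : m * nw + h * dw + h * x + h * x + (s + (h - 2) * z)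
  - (m * nw + h * dw + s) = h * (2 * x) + (h - 2) * z by ring.
apply: (le_trans (ler_normD _ _)); apply: (le_trans (lerD xb zb)).
have t1 : 0 <= dl * (h * dw) by rewrite mulr_ge0 // ltW.
have t2 : 0 <= dl * s by rewrite mulr_ge0 // ltW.
have t3 : 0 <= (c1 + c2) * (dl * (m * nw)).
  by apply: mulr_ge0; [lra|exact: mulr_ge0 (ltW dl0) _].
have t4 : 0 <= (c1 + c2) * (dl * (h * dw)).
  by apply: mulr_ge0; [lra|exact: mulr_ge0 (ltW dl0) _].
lra.
Qed.

End Perturbation.

(** * Weighted graph Laplacians on the grid *)

Section Grid.
Variables (R : realType) (N : nat) (H : {set cell N}).
Let L : {set cell N} := ~: H.
Implicit Types (p q r : cell N) (f w : cell N -> cell N -> R) (x : cell N -> R).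

Lemma adjacentC p q : adjacent p q = adjacent q p.
Proof.
rewrite /adjacent [q.1 == p.1]eq_sym [q.2 == p.2]eq_sym.
by congr ((_ && _) || (_ && _)); rewrite orbC.
Qed.

Lemma adjacentxx p : adjacent p p = false.
Proof. by rewrite /adjacent !eqxx /= !gtn_eqF. Qed.

(** Lowering the first coordinate step by step leads from any cell to one with first coordinate 0,
    which has a boundary edge. *)
Lemma grid_poincare x :
  (forall p q, adjacent p q -> x p = x q) ->
  (forall p, nb_boundary_edges p != 0%N -> x p = 0) -> forall p, x p = 0.
Proof.
move=> xA xB [[i iN] j]; elim: i iN => [|i IHi] iN.
  by apply: xB; rewrite /nb_boundary_edges /=.
rewrite -(IHi (ltnW iN)); apply: xA.
by rewrite /adjacent /= !eqxx orbT orbT.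
Qed.

(** The graph Laplacian with edge weights [w], without boundary terms. It is linear in [w], so
    splitting the weights splits the matrix. *)
Definition lap w p q : R :=
  (p == q)%:R * (\sum_(r | adjacent p r) w p r) - (adjacent p q)%:R * w p q.

Lemma lap_sym w : (forall p q, w p q = w q p) ->
  forall p q, lap w p q = lap w q p.
Proof.
move=> wC p q; rewrite /lap adjacentC wC eq_sym.
by case: eqVneq => [->|_] //; rewrite !mul0r.
Qed.

Lemma lap_rowsum w p : \sum_q lap w p q = 0.
Proof.
rewrite sumrB (bigD1 p) //= eqxx mul1r [X in _ + X - _]big1 => [|q].
  rewrite addr0 big_mkcond -sumrB big1 // => q _.
  by case: (adjacent p q); rewrite ?mul1r ?mul0r subrr.
by rewrite eq_sym => /negPf ->; rewrite mul0r.
Qed.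

Lemma lap_form w x : (forall p q, w p q = w q p) ->
  \sum_p \sum_q x p * lap w p q * x q =
  2^-1 * \sum_p \sum_q (adjacent p q)%:R * w p q * (x p - x q) ^+ 2.
Proof.
move=> wC; pose F p q := (adjacent p q)%:R * w p q * (x p ^+ 2 - x p * x q).
have -> : \sum_p \sum_q x p * lap w p q * x q = \sum_p \sum_q F p q.
  apply: eq_bigr => p _;
    transitivity (x p ^+ 2 * (\sum_(r | adjacent p r) w p r)
      - \sum_q (adjacent p q)%:R * w p q * (x p * x q)).
    rewrite [X in X - _](_ : _ = \sum_q
        x p * ((p == q)%:R * \sum_(r | adjacent p r) w p r) * x q).
      by rewrite -sumrB; apply: eq_bigr => q _; rewrite /lap; ring.
    rewrite [RHS](bigD1 p) //= eqxx mul1r [X in _ + X]big1 => [|q].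
      by rewrite addr0; ring.
    by rewrite eq_sym => /negPf ->; rewrite !mul0r mulr0 mul0r.
  rewrite mulr_sumr big_mkcond -sumrB; apply: eq_bigr => q _; rewrite /F.
  by case: adjacent; rewrite ?mul1r ?mul0r ?subrr // mulrBr; ring.
(* Symmetrizing in [p] and [q] turns [x_p^2 - x_p x_q] into [(x_p - x_q)^2]. *)
rewrite [RHS](_ : _ = 2^-1 * (\sum_p \sum_q F p q + \sum_p \sum_q F q p)).
  by rewrite [X in _ + X]exchange_big /=; field.
congr (_ * _); rewrite -big_split; apply: eq_bigr => p _ /=.
rewrite -big_split; apply: eq_bigr => q _ /=.
by rewrite /F adjacentC wC; ring.
Qed.

(* Edge weights splitting [K(m)] into its parts of order [m], [h] and [1]. *)
Definition wHH p q : R := ((p \in H) && (q \in H))%:R.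
Definition wHL p q : R := ((p \in H) (+) (q \in H))%:R.
Definition wLL p q : R := ((p \notin H) && (q \notin H))%:R.

Lemma wHHC p q : wHH p q = wHH q p. Proof. by rewrite /wHH andbC. Qed.
Lemma wHLC p q : wHL p q = wHL q p. Proof. by rewrite /wHL addbC. Qed.
Lemma wLLC p q : wLL p q = wLL q p. Proof. by rewrite /wLL andbC. Qed.

(** The Dirichlet boundary terms belong to the part independent of [m], since an interior island has
    no boundary edge. *)
Definition lapLL p q : R :=
  lap wLL p q + (p == q)%:R * (2 * (nb_boundary_edges p)%:R).

Lemma lapLLC p q : lapLL p q = lapLL q p.
Proof.
rewrite /lapLL (lap_sym wLLC) [q == p]eq_sym.
by case: eqVneq => [->|_] //; rewrite !mul0r.
Qed.

Lemma lapHH_eq0 p q : ~~ ((p \in H) && (q \in H)) -> lap wHH p q = 0.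
Proof.
move=> pqH; rewrite /lap {2}/wHH (negPf pqH) mulr0 subr0.
have [pq|_] := eqVneq p q; last by rewrite mul0r.
move: pqH; rewrite -pq andbb => /negPf pH; rewrite mul1r big1 // => r _.
by rewrite /wHH pH.
Qed.

Definition hmean (m : R) : R := 2 * m / (m + 1).

Lemma harmonicE m p q : 0 < m ->
  harmonic H m p q = m * wHH p q + hmean m * wHL p q + wLL p q.
Proof.
move=> m0; rewrite /harmonic /alpha /wHH /wHL /wLL /hmean.
have n0 : m + 1 != 0 by rewrite gt_eqF // addr_gt0.
have mm : m + m != 0 by rewrite gt_eqF // addr_gt0.
by case: (p \in H); case: (q \in H) => /=; field => //=;
  rewrite ?[1 + m]addrC ?n0 ?mm.
Qed.

Definition blk (A B : {set cell N}) f : 'M[R]_(#|A|, #|B|) :=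
  \matrix_(i, j) f (enum_val i) (enum_val j).

Lemma tr_blk A B f : (forall p q, f p q = f q p) -> (blk A B f)^T = blk B A f.
Proof. by move=> fC; apply/matrixP => i j; rewrite !mxE. Qed.

Lemma sum_split (F : cell N -> R) :
  \sum_p F p = \sum_(i < #|H|) F (enum_val i) + \sum_(j < #|L|) F (enum_val j).
Proof.
rewrite (bigID (mem H)) /= -!big_enum_val; congr (_ + _).
by apply: eq_bigl => p; rewrite !inE.
Qed.

(** Glues [u] and [v] into one function on cells. For each [p] the two sums have exactly one term in
    all, so no membership proof is needed to invert [enum_val]. *)
Definition ext (u : 'rV[R]_#|H|) (v : 'rV[R]_#|L|) p : R :=
  \sum_(i | enum_val i == p) u 0 i + \sum_(j | enum_val j == p) v 0 j.

Lemma ext_H u v i : ext u v (enum_val i) = u 0 i.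
Proof.
rewrite /ext (big_pred1 i) => [|j]; last by rewrite (inj_eq enum_val_inj).
rewrite big1 ?addr0 // => j /eqP ji.
by have := enum_valP j; rewrite ji inE enum_valP.
Qed.

Lemma ext_L u v j : ext u v (enum_val j) = v 0 j.
Proof.
rewrite /ext addrC (big_pred1 j) => [|i]; last by rewrite (inj_eq enum_val_inj).
rewrite big1 ?addr0 // => i /eqP ij.
by have := enum_valP j; rewrite -ij inE enum_valP.
Qed.

Lemma bform_blk f u v :
  bform (block_mx (blk H H f) (blk H L f) (blk L H f) (blk L L f))
    (row_mx u v) (row_mx u v) = \sum_p \sum_q ext u v p * f p q * ext u v q.
Proof.
rewrite bform_block !bform_sum sum_split.
under [X in _ = X + _]eq_bigr => i _ do rewrite sum_split.
under [X in _ = _ + X]eq_bigr => i _ do rewrite sum_split.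
rewrite !big_split /= -!addrA; congr (_ + _);
  last rewrite addrCA; last congr (_ + (_ + _)).
all: apply: eq_bigr => i _; apply: eq_bigr => j _; by rewrite mxE ?ext_H ?ext_L.
Qed.

Lemma bform_blkHH f u :
  bform (blk H H f) u u = \sum_p \sum_q ext u 0 p * f p q * ext u 0 q.
Proof. by rewrite -bform_blk bform_block !bform0l !bform0r !addr0. Qed.

Lemma lap_form_ge0 w x : (forall p q, w p q = w q p) ->
  (forall p q, 0 <= w p q) ->
  0 <= \sum_p \sum_q x p * lap w p q * x q.
Proof.
move=> wC w0; rewrite lap_form //; apply: mulr_ge0; first by rewrite invr_ge0.
apply: sumr_ge0 => p _; apply: sumr_ge0 => q _.
exact: mulr_ge0 (mulr_ge0 (ler0n _ _) (w0 _ _)) (sqr_ge0 _).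
Qed.

Lemma lap_form_eq0 w x p q : (forall p q, w p q = w q p) ->
  (forall p q, 0 <= w p q) -> \sum_p \sum_q x p * lap w p q * x q = 0 ->
  adjacent p q -> 0 < w p q -> x p = x q.
Proof.
move=> wC w0; rewrite lap_form // => /eqP.
rewrite mulf_eq0 invr_eq0 pnatr_eq0 /=.
have F0 r s : 0 <= (adjacent r s)%:R * w r s * (x r - x s) ^+ 2.
  exact: mulr_ge0 (mulr_ge0 (ler0n _ _) (w0 _ _)) (sqr_ge0 _).
move=> /eqP sE pq wpq.
have G0 r : 0 <= \sum_s (adjacent r s)%:R * w r s * (x r - x s) ^+ 2.
  exact: sumr_ge0.
have := @psumr_eq0P _ _ _ _ (fun s _ => F0 p s)
  (@psumr_eq0P _ _ _ _ (fun r _ => G0 r) sE p isT) q isT.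
by move/eqP; rewrite pq mul1r mulf_eq0 (gt_eqF wpq) sqrf_eq0 subr_eq0 => /eqP.
Qed.

End Grid.

(** * The finite volume matrix as an island matrix *)

Section GridIsland.
Variables (R : realType) (N : nat) (H : {set cell N}).
Let L : {set cell N} := ~: H.
Hypothesis H_neq0 : exists p : cell N, p \in H.
Hypothesis H_connected : edge_connected H.
Hypothesis H_interior : forall p : cell N, p \in H -> nb_boundary_edges p = 0%N.

Local Notation fHH := (lap (wHH R H)).
Local Notation fHL := (lap (wHL R H)).
Local Notation fLL := (lapLL R H).
Local Notation NH := (blk H H fHH).
Local Notation DH := (blk H H fHL).
Local Notation AHL := (- blk H L fHL).
Local Notation TL := (blk L L fLL).
Local Notation EL := (blk L L fHL).
Local Notation e := (eH R H).

Lemma fLL_eq0 p q : (p \in H) || (q \in H) -> fLL p q = 0.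
Proof.
move=> pqH; rewrite /lapLL /lap {2}/wLL -negb_or pqH mulr0 subr0.
have [pq|_] := eqVneq p q; last by rewrite !mul0r addr0.
move: pqH; rewrite -pq orbb => pH; rewrite !mul1r big1 => [|r _].
  by rewrite H_interior // mulr0 addr0.
by rewrite /wLL pH.
Qed.

Lemma KcoefE m p q : 0 < m ->
  Kcoef H m p q = m * fHH p q + hmean m * fHL p q + fLL p q.
Proof.
move=> m0; rewrite /Kcoef /lapLL /lap.
have [<-|pq] := eqVneq p q.
  rewrite adjacentxx !mul1r !mul0r !subr0.
  under eq_bigr => r _ do rewrite harmonicE //.
  rewrite !big_split /= -!mulr_sumr -!addrA; do !congr (_ + _).
  rewrite /alpha; case: ifP => [/H_interior ->|_]; first by rewrite !mulr0.
  by rewrite mulr1.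
rewrite !mul0r !sub0r addr0; case: ifP => _;
  rewrite ?harmonicE ?mul1r ?mul0r //; ring.
Qed.

(** Here [m] and [h] are independent, because [schur_posdef] tests the pair [(1, 2)], which is not
    of the form [(m, hmean m)]. *)
Lemma island_blk m h (f : cell N -> cell N -> R) :
  (forall p q, f p q = m * fHH p q + h * fHL p q + fLL p q) ->
  island_mx NH DH AHL TL EL m h =
  block_mx (blk H H f) (blk H L f) (blk L H f) (blk L L f).
Proof.
move=> fE; have fHLC := lap_sym (wHLC R H).
have inL (j : 'I_#|L|) : enum_val j \notin H.
  by have := enum_valP j; rewrite inE.
rewrite /island_mx; congr block_mx; apply/matrixP => i j; rewrite !mxE fE.
- by rewrite fLL_eq0 ?enum_valP // addr0.
- rewrite fLL_eq0 ?enum_valP // lapHH_eq0 ?(negPf (inL _)) ?andbF //.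
  by rewrite mulr0 add0r addr0 mulrNN.
- rewrite fLL_eq0 ?enum_valP ?orbT // lapHH_eq0 ?(negPf (inL _)) //.
  by rewrite mulr0 add0r addr0 mulrNN fHLC.
- by rewrite lapHH_eq0 ?(negPf (inL _)) // mulr0 add0r addrC.
Qed.

Lemma KmxE m : 0 < m -> Kmx H m = island_mx NH DH AHL TL EL m (hmean m).
Proof. by move=> m0; rewrite (island_blk (fun p q => KcoefE p q m0)). Qed.

Lemma card_H_gt0 : (0 < #|H|)%N.
Proof. by case: H_neq0 => p pH; apply/card_gt0P; exists p. Qed.

Lemma eH_unit : e^T *m e = 1%:M.
Proof.
have n0 : (#|H|%:R : R) != 0 by rewrite pnatr_eq0 -lt0n card_H_gt0.
apply/matrixP => i j; rewrite !ord1 !mxE eqxx.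
under eq_bigr => k _ do rewrite !mxE.
rewrite sumr_const card_ord -powRD ?n0 ?implybT //.
have -> : - 2^-1 + - 2^-1 = -1 :> R by field.
by rewrite powR_inv1 ?ler0n // -[_ *+ _]mulr_natr mulVf.
Qed.

Lemma eH_coef_neq0 : (#|H|%:R : R) `^ (- 2^-1) != 0.
Proof. by rewrite gt_eqF // powR_gt0 // ltr0n card_H_gt0. Qed.

(** Row sums of a Laplacian vanish, and the weights [wHH] give no entry outside the island. *)
Lemma NH_eH : NH *m e = 0.
Proof.
apply/matrixP => i j; rewrite !mxE.
under eq_bigr => k _ do rewrite !mxE.
rewrite -mulr_suml; have := lap_rowsum (wHH R H) (enum_val i).
rewrite (sum_split H) [X in _ + X]big1 => [|k _].
  by rewrite addr0 => ->; rewrite mul0r.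
rewrite lapHH_eq0 //; have := enum_valP k; rewrite inE => /negPf ->.
by rewrite andbF.
Qed.

Lemma NH_ge0 u : 0 <= bform NH u u.
Proof.
by rewrite bform_blkHH; apply: lap_form_ge0 => p q; [exact: wHHC|exact: ler0n].
Qed.

Lemma DH_ge0 u : 0 <= bform DH u u.
Proof.
by rewrite bform_blkHH; apply: lap_form_ge0 => p q; [exact: wHLC|exact: ler0n].
Qed.

(** Zero energy makes [u] constant along paths inside the connected island, and a constant
    orthogonal to [e] is zero. *)
Lemma NH_ker u : bform NH u u = 0 -> u *m e = 0 -> u = 0.
Proof.
rewrite bform_blkHH => u0 ue.
have step p q : p \in H -> q \in H -> adjacent p q -> ext u 0 p = ext u 0 q.
  move=> pH qH pq; apply: (lap_form_eq0 _ _ u0 pq) => [r s|r s|].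
  - by rewrite wHHC.
  - exact: ler0n.
  - by rewrite /wHH pH qH ltr01.
have cst p q : p \in H -> q \in H -> ext u 0 p = ext u 0 q.
  move=> pH qH; have /connectP[s sP ->] := H_connected pH qH.
  elim: s p {pH} sP => //= r s IHs p /andP[/and3P[pH rH pr] /IHs <-].
  exact: step.
have [p pH] := H_neq0.
have uE i : u 0 i = ext u 0 p by rewrite -(ext_H u 0 i) (cst _ p) ?enum_valP.
have /matrixP/(_ 0 0) := ue; rewrite !mxE.
under eq_bigr => i _ do rewrite uE mxE.
rewrite sumr_const card_ord => /eqP.
rewrite mulrn_eq0 (gtn_eqF card_H_gt0) mulf_eq0 (negPf eH_coef_neq0) orbF.
move=> /eqP x0.
by apply/rowP => i; rewrite uE x0 mxE.
Qed.

(** The form is an energy with all edge weights positive plus boundary squares; if both vanish,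
    [grid_poincare] applies. *)
Lemma grid_island_posdef m h : 0 < m -> 0 < h ->
  posdef (island_mx NH DH AHL TL EL m h).
Proof.
move=> m0 h0; pose w p q := m * wHH R H p q + h * wHL R H p q + wLL R H p q.
have wC p q : w p q = w q p by rewrite /w wHHC wHLC wLLC.
have w0 p q : 0 < w p q.
  by rewrite /w /wHH /wHL /wLL; case: (p \in H); case: (q \in H) => /=; lra.
pose f p q := lap w p q + (p == q)%:R * (2 * (nb_boundary_edges p)%:R).
have fE p q : f p q = m * fHH p q + h * fHL p q + fLL p q.
  rewrite /f /lapLL /lap /w !big_split /= -!mulr_sumr; ring.
rewrite (island_blk fE).
have fC p q : f p q = f q p.
  by rewrite !fE (lap_sym (wHHC R H)) (lap_sym (wHLC R H)) lapLLC.
split; first by rewrite tr_block_mx !tr_blk.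
move=> v; rewrite -(hsubmxK v) bform_blk.
move: (lsubmx v) (rsubmx v) => {}v u vn0.
set x := ext v u.
have bE : \sum_p \sum_q
      x p * ((p == q)%:R * (2 * (nb_boundary_edges p)%:R)) * x q
    = \sum_p 2 * (nb_boundary_edges p)%:R * x p ^+ 2.
  apply: eq_bigr => p _; rewrite (bigD1 p) //= eqxx mul1r big1 => [|q].
    by rewrite addr0; ring.
  by rewrite eq_sym => /negPf ->; rewrite mul0r mulr0 mul0r.
have b0 p : 0 <= 2 * (nb_boundary_edges p)%:R * x p ^+ 2.
  by rewrite mulr_ge0 ?sqr_ge0 // mulr_ge0.
have -> : \sum_p \sum_q x p * f p q * x q =
    \sum_p \sum_q x p * lap w p q * x q +
    \sum_p 2 * (nb_boundary_edges p)%:R * x p ^+ 2.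
  rewrite -bE -big_split; apply: eq_bigr => p _ /=; rewrite -big_split.
  by apply: eq_bigr => q _ /=; rewrite /f; ring.
have l0 := lap_form_ge0 x wC (fun p q => ltW (w0 p q)).
have s0 := sumr_ge0 _ (fun p (_ : true) => b0 p).
rewrite lt_neqAle addr_ge0 // andbT eq_sym.
apply: contraNneq vn0 => /eqP; rewrite paddr_eq0 // => /andP[/eqP lE /eqP sE].
have x0 : forall p, x p = 0.
  apply: grid_poincare => [p q pq|p pB].
    exact: (lap_form_eq0 wC (fun p q => ltW (w0 p q)) lE pq).
  have /eqP := @psumr_eq0P _ _ _ _ (fun p _ => b0 p) sE p isT.
  by rewrite !mulf_eq0 !pnatr_eq0 (negPf pB) /= orbb => /eqP.
apply/eqP/rowP => k; rewrite !mxE; case: (fintype.split k) => i.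
  by rewrite -(ext_H v u).
by rewrite -(ext_L v u).
Qed.

(** * Limits of the blocks and identification of the preconditioner *)

Lemma two_sub_hmean (m : R) : 0 < m -> 2 - hmean m = 2 / (m + 1).
Proof. by move=> m0; rewrite /hmean; field; lra. Qed.

Lemma hmean_cvg : hmean m @[m --> +oo] --> (2 : R).
Proof.
apply/cvgrPdist_le => eps eps0; near=> m.
have m0 : 0 < m by near: m; apply: nbhs_pinfty_gt; rewrite num_real.
have m10 : 0 < m + 1 by rewrite addr_gt0.
rewrite two_sub_hmean //.
rewrite ger0_norm; last by rewrite divr_ge0 // ltW.
rewrite ler_pdivrMr //.
have : 2 / eps < m by near: m; apply: nbhs_pinfty_gt; rewrite num_real.
by rewrite ltr_pdivrMr //; lra.
Unshelve. all: by end_near. Qed.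

Lemma hmean_lim (f : R -> R) (a b : R) :
  (forall m, 0 < m -> f m = hmean m * a + b) ->
  lim (f m @[m --> +oo]) = 2 * a + b.
Proof.
move=> fE; apply/cvg_lim => //.
apply: cvg_trans (cvgD (cvgM hmean_cvg (cvg_cst a)) (cvg_cst b)).
apply: near_eq_cvg; near=> m.
rewrite fE //; near: m; apply: nbhs_pinfty_gt; exact: num_real.
Unshelve. all: by end_near. Qed.

(** Outside the island block no entry carries the factor [m], so each entry is affine in
    [hmean m]. *)
Lemma Kblock_limE (A B : {set cell N}) : A \subset L \/ B \subset L ->
  Kblock_lim R H A B = 2 *: blk A B fHL + blk A B fLL.
Proof.
move=> AB; apply/matrixP => i j; rewrite !mxE; apply: hmean_lim => m m0.
rewrite mxE KcoefE // lapHH_eq0 ?mulr0 ?add0r //.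
rewrite negb_and; case: AB => /fintype.subsetP sub.
  by have := sub _ (enum_valP i); rewrite inE => ->.
by have := sub _ (enum_valP j); rewrite inE => ->; rewrite orbT.
Qed.

Lemma Kblock_limHL : Kblock_lim R H H L = - 2 *: AHL.
Proof.
rewrite Kblock_limE; last by right.
rewrite [X in _ + X](_ : _ = 0) ?addr0 ?scaleNr ?scalerN ?opprK //.
by apply/matrixP => i j; rewrite !mxE fLL_eq0 // enum_valP.
Qed.

Lemma Kblock_limLH : Kblock_lim R H L H = - 2 *: AHL^T.
Proof.
rewrite Kblock_limE; last by left.
rewrite [X in _ + X](_ : _ = 0) ?addr0 ?scaleNr ?scalerN.
  by rewrite linearN /= scalerN opprK tr_blk //; apply/lap_sym/wHLC.
by apply/matrixP => i j; rewrite !mxE fLL_eq0 // enum_valP orbT.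
Qed.

Lemma Kblock_limLL : Kblock_lim R H L L = TL + 2 *: EL.
Proof. by rewrite Kblock_limE 1?addrC //; left. Qed.

(** The part of order [m] drops out of [eta] because [e] is in the kernel of [NH]. *)
Lemma eta_limE : eta_lim R H = 2 * coupling DH e.
Proof.
rewrite /eta_lim -[RHS]addr0; apply: hmean_lim => m m0.
have -> : eta H m = bform (Kblock H H H m) e^T e^T by rewrite /eta /bform trmxK.
have /eq_block_mx[-> _ _ _] := KmxE m0.
by rewrite bformDm !bformZm bform_N_e ?NH_eH // mulr0 add0r addr0.
Qed.

Lemma QLH_limE : QLH_lim R H = shear DH AHL e.
Proof.
rewrite /QLH_lim /KHH_dagger Kblock_limLH eta_limE /shear.
rewrite mul_mx_scalar !mulmxA -!scalemxAl -!scalemxAr -!scalemxAl.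
rewrite scalerA -scaleNr.
by congr (_ *: _); rewrite invfM mulrA mulNr divff ?pnatr_eq0 // mulN1r.
Qed.

Lemma S_limE : S_lim R H = schur DH AHL TL EL e.
Proof.
rewrite /S_lim -/(QLH_lim R H) QLH_limE Kblock_limHL Kblock_limLL /schur /shear.
congr (_ - _); rewrite /coupling_sqr mulNmx -scalemxAr -!scalemxAl scalerA.
by rewrite mulNr scaleNr opprK.
Qed.

Lemma B_AGKS_inv m : 0 < m ->
  B_AGKS H m *m precond_inv_mx NH DH AHL TL EL e m (hmean m) = 1%:M.
Proof.
move=> m0; have h0 : 0 < hmean m by rewrite divr_gt0 ?mulr_gt0 ?addr_gt0.
have uK : m *: NH + hmean m *: DH \in unitmx.
  apply: posdef_unit; apply: (island_HH_posdef (A := AHL) (T := TL) (E := EL)).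
  - by apply: tr_blk; apply/lap_sym/wHHC.
  - by apply: tr_blk; apply/lap_sym/wHLC.
  - exact: grid_island_posdef.
  - exact: m0.
  - exact: h0.
have uS : schur DH AHL TL EL e \in unitmx.
  apply: posdef_unit; apply: (schur_posdef (N := NH)).
  - exact: eH_unit.
  - by apply: tr_blk; apply/lap_sym/wHHC.
  - by apply: tr_blk; apply/lap_sym/wHLC.
  - by apply: tr_blk; apply/lapLLC.
  - by apply: tr_blk; apply/lap_sym/wHLC.
  - exact: NH_eH.
  - exact: grid_island_posdef.
rewrite /B_AGKS /precond_inv_mx QLH_limE S_limE.
have /eq_block_mx[-> _ _ _] := KmxE m0.
set Q := shear _ _ _.
have LL : block_mx 1%:M 0 (- Q) 1%:M *m block_mx 1%:M 0 Q 1%:M = 1%:M.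
  rewrite mulmx_block !mul1mx !mulmx1 !mul0mx !mulmx0 !addr0 !add0r addNr.
  by rewrite -scalar_mx_block.
have UU : block_mx 1%:M (- Q^T) 0 1%:M *m block_mx 1%:M Q^T 0 1%:M = 1%:M.
  rewrite mulmx_block !mul1mx !mulmx1 !mul0mx !mulmx0 !addr0 !add0r subrr.
  by rewrite -scalar_mx_block.
rewrite -!mulmxA [block_mx _ _ (- Q) _ *m _]mulmxA LL mul1mx.
rewrite [block_mx (invmx _) _ _ _ *m _]mulmxA mulmx_block !mulVmx //.
by rewrite !mul0mx !mulmx0 !addr0 !add0r -scalar_mx_block mul1mx UU.
Qed.

Lemma spectrum_bound : exists2 c : R, 0 < c & forall m, 1 <= m ->
  spectrum (B_AGKS H m *m Kmx H m) `<=`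
  real_complex R @` `[1 - c * m `^ (- 2^-1), 1 + c * m `^ (- 2^-1)].
Proof.
have sN : NH^T = NH by apply: tr_blk; apply/lap_sym/wHHC.
have sD : DH^T = DH by apply: tr_blk; apply/lap_sym/wHLC.
have sT : TL^T = TL by apply: tr_blk; apply/lapLLC.
have sE : EL^T = EL by apply: tr_blk; apply/lap_sym/wHLC.
have [c c0 cP] := island_precond_close eH_unit sN sD sT sE
  NH_eH NH_ge0 DH_ge0
  NH_ker grid_island_posdef.
exists c => // m m1; have m0 : 0 < m by rewrite (lt_le_trans ltr01).
have h0 : 0 < hmean m by rewrite divr_gt0 ?mulr_gt0 ?addr_gt0.
have m10 : 0 < m + 1 by rewrite addr_gt0.
rewrite KmxE //; apply: (spectrum_pencil (B_AGKS_inv m0)).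
- exact: (grid_island_posdef m0 h0).1.
- exact: (precond_inv_posdef eH_unit sN sD sT sE NH_eH
    grid_island_posdef).
(* The scale is [m^(-1/2)]; the bounds on [h] follow from [2 - h = 2 / (m + 1)]. *)
apply: cP => //.
- exact: powR_gt0.
- rewrite expr2 -powRD ?(gt_eqF m0) ?implybT //.
  have -> : - 2^-1 + - 2^-1 = -1 :> R by field.
  by rewrite powR_inv1 ?(ltW m0) // mulVf // gt_eqF.
- by rewrite -subr_ge0 two_sub_hmean // divr_ge0 // ltW.
- rewrite two_sub_hmean // ler_pdivrMr // mulrAC ler_pdivlMr //.
  by rewrite ler_pM2l // lerDl.
Qed.

End GridIsland.

(** * Spectral inclusion and asymptotics of the condition number *)

Theorem theorem1 (R : realType) (N : nat) (H : {set cell N})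
  (H_nonempty : exists p : cell N, p \in H)
  (H_connected : edge_connected H)
  (H_interior : forall p : cell N, p \in H -> nb_boundary_edges p = 0%N) :
  (exists c m0 : R, [/\ 0 < c, 1 <= m0 &
     forall m : R, m0 <= m ->
       spectrum (B_AGKS H m *m Kmx H m) `<=`
       real_complex R @` `[1 - c * m `^ (- 2^-1), 1 + c * m `^ (- 2^-1)]])
  /\
  (exists2 C : R, 0 < C &
     \forall m \near +oo,
       `|kappa (B_AGKS H m *m Kmx H m) - 1| <= C * `|m `^ (- 2^-1)|).
Proof.
have [c c0 cP] := spectrum_bound R H_nonempty H_connected H_interior.
split; first by exists c, 1; split.
exists (4 * c); first lra.
near=> m.
have m1 : 1 <= m by near: m; apply: nbhs_pinfty_ge; exact: num_real.
(* This threshold makes [c m^(-1/2) <= 1 / 2], as [kappa_near1] requires. *)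
have mc : 4 * c ^+ 2 <= m by near: m; apply: nbhs_pinfty_ge; exact: num_real.
have m0 : 0 < m by rewrite (lt_le_trans ltr01).
rewrite [`|m `^ _|]ger0_norm ?powR_ge0 // -mulrA; apply: kappa_near1 (cP _ m1).
  by rewrite addn_gt0 card_H_gt0.
have r0 : 0 < m `^ 2^-1 by rewrite powR_gt0.
have rr : m `^ 2^-1 ^+ 2 = m.
  rewrite expr2 -powRD ?(gt_eqF m0) ?implybT //.
  have -> : 2^-1 + 2^-1 = 1 :> R by field.
  by rewrite powRr1 // ltW.
rewrite powRN ler_pdivrMr //.
suff : 2 * c <= m `^ 2^-1 by lra.
by rewrite -ler_sqr ?nnegrE ?(ltW r0) ?mulr_ge0 ?(ltW c0) // rr exprMn; lra.
Unshelve. all: by end_near. Qed.
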